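(* Let $X$ be a Banach space and let $T\colon X\to X$ be a bounded linear operator. Then $T$ is weakly demi Dunford-Pettis if and only if for all sequences $(x_j)_{j=1}^{\infty}$ in $X$ and $(f_j)_{j=1}^{\infty}$ in $X'$ and all $x\in X$, $f\in X'$ such that $x_j\to x$ weakly in $X$, $f_j\to f$ weakly in $X'$, and $x_j-T(x_j)\to x-T(x)$ in norm, one has $f_j(x_j)\to f(x)$ as $j\to\infty$.
   Context: $X'$ and $X''$ denote the topological dual and bidual of $X$. Weak convergence in $X$ means convergence in $\sigma(X,X')$; weak convergence in $X'$ means convergence in $\sigma(X',X'')$. A bounded linear operator $T\colon X\to X$ is weakly demi Dunford-Pettis if for all sequences $(x_j)_{j=1}^{\infty}$ in $X$ and $(f_j)_{j=1}^{\infty}$ in $X'$ with $x_j\to 0$ weakly in $X$, $f_j\to 0$ weakly in $X'$ and $\|x_j-T(x_j)\|\to 0$, one has $|f_j(x_j)|\to 0$ as $j\to\infty$. *)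

(* Defs.v *)
From HB Require Import structures.
From mathcomp Require Import all_boot all_order all_algebra.
From mathcomp Require Import complex.
From mathcomp Require Import all_classical all_reals all_analysis.

Set Implicit Arguments.
Unset Strict Implicit.
Unset Printing Implicit Defensive.

Import Order.TTheory GRing.Theory Num.Theory.
Import numFieldNormedType.Exports.

Local Open Scope classical_set_scope.
Local Open Scope ring_scope.

(* A Banach space may be real or complex. Both scalar fields are covered by
   numFieldType together with the least-upper-bound property for sets of
   nonnegative elements, which is what makes the operator norm exist: see the
   instances for [R : realType] and for [R[i]] below. *)
HB.mixin Record NumField_hasNonnegLub K of Num.NumField K := {
  nonneg_lub : forall A : set K,
    A !=set0 -> A `<=` [set x | 0 <= x] -> has_ubound A -> supremums A !=set0
}.

#[short(type="scalarFieldType")]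
HB.structure Definition ScalarField :=
  { K of Num.NumField K & NumField_hasNonnegLub K }.

Section scalar_instances.
Variable R : realType.

Lemma real_nonneg_lub (A : set R) :
  A !=set0 -> A `<=` [set x | 0 <= x] -> has_ubound A -> supremums A !=set0.
Proof.
move=> A0 _ uA; exists (sup A); split; first exact: sup_upper_bound.
by move=> M MA; exact: ge_sup.
Qed.

HB.instance Definition _ := NumField_hasNonnegLub.Build R real_nonneg_lub.

Lemma complex_nonneg_lub (A : set R[i]) :
  A !=set0 -> A `<=` [set x | 0 <= x] -> has_ubound A -> supremums A !=set0.
Proof.
move=> [a Aa] A_ge0 [M MA].
pose B := [set @complex.Re R x | x in A].
have AE x : A x -> x = (@complex.Re R x)%:C%C.
  by move=> /A_ge0 /= /ger0_real /RRe_real ->.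
have MRe y : ubound A y -> (@complex.Re R y)%:C%C = y.
  move=> /(_ _ Aa) ay; apply: RRe_real; apply: ger0_real.
  exact: le_trans (A_ge0 _ Aa) ay.
have B0 : B !=set0 by exists (complex.Re a); exists a.
have UB y : ubound A y -> ubound B (complex.Re y).
  move=> uy _ [x Ax <-]; have := uy _ Ax.
  by rewrite -(MRe _ uy) [in X in X -> _](AE _ Ax) lecR.
have uB : has_ubound B by exists (complex.Re M); exact: UB.
exists ((sup B)%:C%C); split.
  move=> x Ax; rewrite (AE _ Ax) lecR.
  by apply: sup_upper_bound; [split|exists x].
move=> y uy; rewrite -(MRe _ uy) lecR.
by apply: ge_sup => //; exact: UB.
Qed.

HB.instance Definition _ :=
  NumField_hasNonnegLub.Build R[i] complex_nonneg_lub.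

End scalar_instances.

Section dual.
Variables (K : scalarFieldType) (V : normedModType K).

Definition continuous_linear : {pred V -> K^o} :=
  [pred f | `[< linear (f : V -> K^o) /\ continuous (f : V -> K^o) >] ].

Record dual : Type := Dual {
  dual_fun :> V -> K^o ;
  dual_funP : dual_fun \in continuous_linear }.

HB.instance Definition _ := [isSub for dual_fun].
HB.instance Definition _ := [Choice of dual by <:].

Lemma continuous_linear_submod : submod_closed continuous_linear.
Proof.
split=> [|a f g]; rewrite !inE.
  by split=> [b x y|x]; [rewrite /= scaler0 addr0|exact: cvg_cst].
move=> [lf cf] [lg cg]; split=> [b x y|x].
  have -> z : (a *: f + g : V -> K^o) z = a *: f z + g z by [].
  by rewrite lf lg !scalerDr !scalerA [b * a]mulrC addrACA.
by apply: cvgD; [apply: cvgZr; exact: cf|exact: cg].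
Qed.

HB.instance Definition _ := GRing.isSubmodClosed.Build _ _ continuous_linear
  continuous_linear_submod.
HB.instance Definition _ := [SubChoice_isSubLmodule of dual by <:].

Lemma dual_linear (f : dual) : linear f.
Proof. by have := dual_funP f; rewrite inE => -[]. Qed.

Lemma dual_continuous (f : dual) : continuous f.
Proof. by have := dual_funP f; rewrite inE => -[]. Qed.

HB.instance Definition _ (f : dual) :=
  GRing.isLinear.Build K V K^o *:%R f (dual_linear f).

Definition op_norm (f : V -> K^o) : K :=
  supremum 0 [set `|f x| | x in [set x : V | `|x| <= 1]].

Let unit_values (f : dual) := [set `|f x| | x in [set x : V | `|x| <= 1]].

Lemma op_norm_supremums (f : dual) : supremums (unit_values f) (op_norm f).
Proof.
have n0 : unit_values f !=set0 by exists `|f 0|, 0; rewrite /= ?normr0.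
have : supremums (unit_values f) !=set0.
  apply: nonneg_lub => //; first by move=> _ [x _ <-] /=.
  have /linear_bounded_continuous/linear_boundedP/pinfty_ex_gt0[M M0 fM] :=
    @dual_continuous f.
  exists M => _ [x /= x1 <-]; rewrite (le_trans (fM x))// ler_piMr//.
  exact: ltW.
move=> [s ss]; rewrite /op_norm /supremum ifF; first by case: xgetP => // /(_ s).
by apply/negbTE/set0P.
Qed.

Lemma op_norm_ge0 (f : dual) : 0 <= op_norm f.
Proof.
have [ub _] := op_norm_supremums f.
by rewrite (le_trans _ (ub `|f 0| _))//; exists 0; rewrite /= ?normr0.
Qed.

Lemma ler_op_norm (f : dual) (x : V) : `|f x| <= op_norm f * `|x|.
Proof.
have [->|x0] := eqVneq x 0; first by rewrite linear0 !normr0 mulr0.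
have nx : 0 < `|x| by rewrite normr_gt0.
have [ub _] := op_norm_supremums f.
rewrite -ler_pdivrMr// mulrC.
have -> : `|x|^-1 * `|f x| = `|f (`|x|^-1 *: x)|.
  by rewrite linearZ/= normrM ger0_norm// invr_ge0.
by apply: ub; exists (`|x|^-1 *: x); rewrite //= normfZV.
Qed.

Lemma op_norm_le (f : dual) (M : K) :
  (forall x, `|x| <= 1 -> `|f x| <= M) -> op_norm f <= M.
Proof.
by move=> fM; have [_] := op_norm_supremums f; apply => _ [x x1 <-]; exact: fM.
Qed.

Lemma ler_op_normD (f g : dual) :
  op_norm (f + g : dual) <= op_norm f + op_norm g.
Proof.
apply: op_norm_le => x x1; apply: (le_trans (ler_normD (f x) (g x))).
by apply: lerD; apply: (le_trans (ler_op_norm _ _));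
  apply: ler_piMr => //; exact: op_norm_ge0.
Qed.

Lemma op_normZ (a : K) (f : dual) :
  op_norm (a *: f : dual) = `|a| * op_norm f.
Proof.
have le (b : K) (g : dual) : op_norm (b *: g : dual) <= `|b| * op_norm g.
  apply: op_norm_le => x x1; rewrite [X in `|X|](_ : _ = b * g x)// normrM.
  apply: ler_wpM2l => //.
  by apply: (le_trans (ler_op_norm _ _)); apply: ler_piMr => //;
    exact: op_norm_ge0.
apply/eqP; rewrite eq_le le andTb.
have [->|a0] := eqVneq a 0; first by rewrite normr0 mul0r; exact: op_norm_ge0.
rewrite -ler_pdivlMl ?normr_gt0// -normfV.
by rewrite (le_trans _ (le a^-1 _))// scalerA mulVf// scale1r.
Qed.

Lemma op_norm0_eq0 (f : dual) : op_norm f = 0 -> f = 0.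
Proof.
move=> f0; apply/val_inj/funext => x; apply/normr0_eq0/eqP.
by rewrite eq_le normr_ge0 andbT (le_trans (ler_op_norm f x))// f0 mul0r.
Qed.

HB.instance Definition _ :=
  Lmodule_isNormed.Build K dual ler_op_normD op_normZ op_norm0_eq0.

(* The coarsest topology on V making every element of its dual continuous.
   At V := dual X, this is sigma(X', X''). *)
Definition weak_topology : Type :=
  sup_topology (fun phi : dual =>
    Topological.class (initial_topology (phi : V -> K^o))).

HB.instance Definition _ := Topological.on weak_topology.

Definition weakly_cvg (u : nat -> V) (l : V) : Prop :=
  cvg_to (u @ \oo) (nbhs (l : weak_topology)).

Lemma weakly_cvgP (u : nat -> V) (l : V) :
  weakly_cvg u l <-> forall phi : dual, phi (u j) @[j --> \oo] --> phi l.
Proof.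
rewrite /weakly_cvg cvg_sup; split=> ul phi.
  by move=> A /(@initial_continuous V K^o phi l) /(ul phi).
move=> A; case=> _ [[B oB <-] Bl sBA]; apply: filterS sBA _.
by apply: (ul phi); exact: open_nbhs_nbhs.
Qed.

End dual.

Definition bounded_operator (K : scalarFieldType) (X : normedModType K)
    (T : X -> X) : Prop :=
  exists M : K, forall x, `|T x| <= M * `|x|.

Definition weakly_demi_Dunford_Pettis (K : scalarFieldType)
    (X : normedModType K) (T : X -> X) : Prop :=
  forall (x : nat -> X) (f : nat -> dual X),
    weakly_cvg x 0 ->
    weakly_cvg f 0 ->
    (`|x j - T (x j)| : K^o) @[j --> \oo] --> (0 : K^o) ->
    (`|f j (x j)| : K^o) @[j --> \oo] --> (0 : K^o).

(* Main.v *)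
Require Import Defs.
From HB Require Import structures.
From mathcomp Require Import all_boot all_order all_algebra.
From mathcomp Require Import all_classical all_reals all_analysis.
From mathcomp Require Import ring.

Import Order.TTheory GRing.Theory Num.Theory.
Import numFieldNormedType.Exports.

Local Open Scope classical_set_scope.
Local Open Scope ring_scope.

(** Everything is translation. Since a weak limit is tested against linear
    functionals, [x_ - x] and [f_ - f] are weakly null, and [T] being linear,
    [(x_ - x) - T (x_ - x)] is norm null; so the weakly demi Dunford-Pettis
    property gives [(f_ j - f) (x_ j - x) --> 0]. Bilinearity of the pairing then
    yields
      [f_ j (x_ j) = (f_ j - f) (x_ j - x) + f (x_ j) + (f_ j x - f x)],
    where [f (x_ j) --> f x] by weak convergence of [x_], and [f_ j x --> f x]
    because evaluation at [x] belongs to the bidual ([evaluation_dual],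
    [weakly_cvg_pointwise]). The converse is the case of null limits. *)

Section weak_convergence.
Context {K : scalarFieldType} {V : normedModType K}.

Lemma weakly_cvg_subl {u : nat -> V} {l : V} :
  weakly_cvg u l -> weakly_cvg (fun j => u j - l) 0.
Proof.
move=> /weakly_cvgP ul; apply/weakly_cvgP => phi.
rewrite linear0 -(subrr (phi l)).
under eq_fun do rewrite linearB.
by apply: cvgB; [exact: ul|exact: cvg_cst].
Qed.

Definition evaluation (x : V) (f : dual V) : K^o := f x.

Lemma evaluation_linear (x : V) : linear (evaluation x).
Proof. by []. Qed.

HB.instance Definition _ (x : V) :=
  GRing.isLinear.Build K (dual V) K^o *:%R (evaluation x) (evaluation_linear x).

(** The bound [`|f x| <= `|f| * `|x|] is what puts evaluation at [x] in the
    bidual. *)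
Lemma evaluation_continuous (x : V) : continuous (evaluation x).
Proof.
apply/linear_bounded_continuous/linear_boundedP; near=> M => f.
by rewrite (le_trans (ler_op_norm f x))// mulrC ler_wpM2r ?op_norm_ge0//.
Unshelve. all: by end_near. Qed.

Lemma evaluation_continuous_linear (x : V) :
  evaluation x \in @continuous_linear K (dual V).
Proof.
rewrite inE; split; first exact: evaluation_linear.
exact: evaluation_continuous.
Qed.

Definition evaluation_dual (x : V) : dual (dual V) :=
  Dual (evaluation_continuous_linear x).

(** Testing weak convergence in the dual against the functionals
    [evaluation_dual x] alone gives weak-star convergence. *)
Lemma weakly_cvg_pointwise {u : nat -> dual V} {f : dual V} (x : V) :
  weakly_cvg u f -> (u j x : K^o) @[j --> \oo] --> (f x : K^o).
Proof. by move=> /weakly_cvgP /(_ (evaluation_dual x)). Qed.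

(** Moving both arguments of the pairing by the limits isolates the one term
    that is quadratic in the errors; the rest converges by weak convergence. *)
Lemma dual_pairing_translate (f g : dual V) (x y : V) :
  g y = (g - f : dual V) (y - x) + f y + (g x - f x).
Proof.
have -> z : (g - f : dual V) z = g z - f z by [].
rewrite !linearB /=; ring.
Qed.

End weak_convergence.

Theorem proposition2p2 (K : scalarFieldType) (X : completeNormedModType K)
    (T : {linear X -> X}) (hT : bounded_operator T) :
  weakly_demi_Dunford_Pettis T <->
  (forall (x_ : nat -> X) (f_ : nat -> dual X) (x : X) (f : dual X),
     weakly_cvg x_ x ->
     weakly_cvg f_ f ->
     (x_ j - T (x_ j)) @[j --> \oo] --> x - T x ->
     f_ j (x_ j) @[j --> \oo] --> f x).
Proof.
split=> [wdDP x_ f_ x f xx ff Txx|cvg_pairing x_ f_ x0 f0 Tx0].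
  have Tx0 : (`|(x_ j - x) - T (x_ j - x)| : K^o) @[j --> \oo] --> (0 : K^o).
    apply/norm_cvg0P.
    have -> : (fun j => (x_ j - x) - T (x_ j - x)) =
              (fun j => (x_ j - T (x_ j)) - (x - T x)).
      by apply/funext => j; rewrite linearB !opprD addrACA.
    rewrite -(subrr (x - T x)).
    by apply: cvgB; [exact: Txx|exact: cvg_cst].
  have /norm_cvg0P fx0 := wdDP _ _ (weakly_cvg_subl xx) (weakly_cvg_subl ff) Tx0.
  under eq_fun do rewrite (dual_pairing_translate f _ x).
  have -> : nbhs (f x) = nbhs (0 + f x + (f x - f x)).
    by rewrite subrr addr0 add0r.
  apply: cvgD.
    by apply: cvgD; [exact: fx0|move/weakly_cvgP: xx; exact].
  by apply: cvgB; [exact: weakly_cvg_pointwise|exact: cvg_cst].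
apply/norm_cvg0P; apply: (cvg_pairing x_ f_ 0 0 x0 f0).
by rewrite linear0 subr0; apply/norm_cvg0P.
Qed.
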